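(* For every integer $l>3$, the starting position of Oriented Blue-Red-coloring on the directed cycle of length $l$ is a $\mathcal{P}$-position.
   Context: Oriented Blue-Red-coloring is the following impartial game on a digraph: two players alternate; a move chooses one uncolored vertex and colors it Blue or Red, subject to the constraint that for each arc $(u,v)$, if both $u$ and $v$ are colored, then $u$ is Blue and $v$ is Red. Both players may use both colors. Colored vertices are never recolored. The player unable to move loses. The starting position is the one with all vertices uncolored. The directed cycle of length $l$ is $v_1\to v_2\to\cdots\to v_l\to v_1$. A position is a $\mathcal{P}$-position if the second player (the one not about to move) has a winning strategy, and an $\mathcal{N}$-position otherwise. *)

(* Defs.v *)
From HB Require Import structures.
From mathcomp Require Import all_boot.

Set Implicit Arguments.
Unset Strict Implicit.
Unset Printing Implicit Defensive.

Inductive color := Blue | Red.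

Definition bool_of_color (c : color) : bool := if c is Blue then true else false.
Definition color_of_bool (b : bool) : color := if b then Blue else Red.

Lemma bool_of_colorK : cancel bool_of_color color_of_bool.
Proof. by case. Qed.

HB.instance Definition _ := Finite.copy color (can_type bool_of_colorK).

Section OrientedBlueRed.

Variables (V : finType) (arc : rel V).

(* [None] means uncolored. *)
Definition position : predArgType := {ffun V -> option color}.

Definition start : position := [ffun=> None].

Definition set_color (p : position) (v : V) (c : color) : position :=
  [ffun w => if w == v then Some c else p w].

Definition admissible (p : position) : bool :=
  [forall u, forall v,
    [&& arc u v, p u != None & p v != None] ==>
    (p u == Some Blue) && (p v == Some Red)].

Definition move (p q : position) : bool :=
  [exists v, exists c, (p v == None) && (q == set_color p v c)] && admissible q.

(* A play from p is the sequence s of positions reached after p, so that the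
   entries of even index (counting from 0) are moves of the first player and
   those of odd index are moves of the second player.  A strategy of the second
   player is a function of the whole play so far. *)
Definition follows (sigma : seq position -> position) (p : position)
    (s : seq position) : Prop :=
  forall i, i < size s -> odd i -> nth p s i = sigma (take i s).

(* Every move colors a new vertex, so all plays are finite and the loser is the
   player who gets stuck.  Hence sigma wins iff it always supplies a legal move
   when the second player is to move. *)
Definition second_player_wins_with (sigma : seq position -> position)
    (p : position) : Prop :=
  forall s, path move p s -> follows sigma p s -> odd (size s) ->
    move (last p s) (sigma s).

Definition P_position (p : position) : Prop :=
  exists sigma, second_player_wins_with sigma p.

End OrientedBlueRed.

Arguments start {V}.

(* The vertices v_1, ..., v_l are numbered 0, ..., l - 1; [ordS] is the
   successor modulo l. *)
Definition directed_cycle (l : nat) : rel 'I_l := fun u v => v == ordS u.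

(* Main.v *)
Require Import Defs.
From mathcomp Require Import all_boot.
From mathcomp Require Import zify.

(** A move is a pair (vertex, color), and whether a set of moves may be on the
board together is decided pair by pair; so the game amounts to enlarging, one
element at a time, a set of pairwise compatible moves.  On the cycle of length
[l], give the move coloring vertex [v] the code [2 v] if the color is Blue and
[2 v + 1] if it is Red.  Two distinct moves clash exactly when their codes, read
modulo [2 l], differ by 1 (both colors of one vertex, or Red followed by Blue)
or by 2 (equal colors on neighbors): see [compatible_cycle].  The game thus has
the full symmetry of a cycle of length [2 l], and the second player answers each
move with the antipodal one, of code shifted by [l] ([antipode]).  Since [l > 2],
a move never clashes with its antipode, and the board stays symmetric, so the
answer is legal whenever the move was; this is the classical pairing argument
([P_position_pairing]).  On the board, the answer is the rotation by [l / 2] with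
the same color if [l] is even, and the opposite color half a turn away if [l] is
odd. *)

Set Implicit Arguments.
Unset Strict Implicit.
Unset Printing Implicit Defensive.

(** * Memoryless strategies and pairing strategies *)

Section Strategies.

Variables (V : finType) (arc : rel V).
Implicit Types (p q r : position V) (a b : V * color).

(** It suffices to restore an invariant after each move of the first player:
the strategy looks only at the last position, and picks any legal reply that
restores the invariant. *)
Lemma P_position_invariant (inv : pred (position V)) p :
    inv p ->
    (forall q r, inv q -> move arc q r -> exists2 t, move arc r t & inv t) ->
  P_position arc p.
Proof.
move=> inv_p restore.
pose good q r := move arc q r && inv r.
pose sigma s := odflt p [pick r | good (last p s) r].
have goodP q r : inv q -> move arc q r -> good r (odflt p [pick t | good r t]).
  move=> inv_q /(restore _ _ inv_q)[t r_t inv_t].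
  by case: pickP => [//|/(_ t)]; rewrite /good r_t inv_t.
exists sigma => s.
suff reached : path (move arc) p s -> follows sigma p s ->
    if odd (size s) then exists2 q, inv q & move arc q (last p s)
    else inv (last p s).
  move=> p_s sigma_s odd_s; have := reached p_s sigma_s; rewrite odd_s.
  by case=> q inv_q /(goodP _ _ inv_q)/andP[].
elim/last_ind: s => [//|s q IHs]; rewrite rcons_path => /andP[p_s s_q] sigma_s.
have sigma_s' : follows sigma p s.
  move=> i lt_i odd_i; have := sigma_s i.
  rewrite size_rcons nth_rcons lt_i -cats1 takel_cat; last exact: ltnW.
  by apply; rewrite // ltnW.
have {}IHs := IHs p_s sigma_s'.
rewrite size_rcons last_rcons /=; case: ifPn => [even_s | ].
  by exists (last p s) => //; move: IHs; rewrite (negbTE even_s).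
rewrite negbK => odd_s; rewrite odd_s in IHs.
have := sigma_s (size s); rewrite size_rcons nth_rcons ltnn eqxx -cats1.
rewrite take_size_cat // => -> //.
by case: IHs => t inv_t /(goodP _ _ inv_t)/andP[].
Qed.

Definition respects_arc a b : bool :=
  arc a.1 b.1 ==> (a.2 == Blue) && (b.2 == Red).

Definition compatible a b : bool :=
  [&& a.1 != b.1, respects_arc a b & respects_arc b a].

Definition played p a : bool := p a.1 == Some a.2.

Definition play p a : position V := set_color p a.1 a.2.

Lemma compatible_sym : symmetric compatible.
Proof.
by move=> a b; rewrite /compatible eq_sym [respects_arc a b && _]andbC.
Qed.

Lemma admissibleP p :
  reflect (forall a b, played p a -> played p b -> respects_arc a b)
    (admissible arc p).
Proof.
apply: (iffP forallP) => [adm [u c] [v d] | ok u].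
  rewrite /played /respects_arc /= => /eqP pu /eqP pv; apply/implyP => uv.
  by have /forallP/(_ v) := adm u; rewrite uv pu pv.
apply/forallP => v; apply/implyP; case/and3P=> uv.
case pu: (p u) => [c|] //; case pv: (p v) => [d|] // _ _.
have := ok (u, c) (v, d); rewrite /played /respects_arc pu pv uv.
exact.
Qed.

Lemma played_play p a b :
  p a.1 = None -> played (play p a) b = (b == a) || played p b.
Proof.
case: a b => [v c] [w d] /= pv; rewrite /played /play ffunE xpair_eqE /=.
by case: (w =P v) => [->|_] //=; rewrite pv orbF eq_sym.
Qed.

Lemma moveP p q :
  move arc p q -> exists a, [/\ p a.1 = None, q = play p a
    & forall b, played p b -> compatible a b].
Proof.
case/andP=> /existsP[v /existsP[c /andP[/eqP pv /eqP ->]]] /admissibleP adm.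
exists (v, c); split=> // b pb.
have played_v : played (play p (v, c)) (v, c) by rewrite played_play ?eqxx.
have played_b : played (play p (v, c)) b by rewrite played_play ?pb ?orbT.
rewrite /compatible !adm // !andbT /=.
by apply: contraTneq pb => eq_v; rewrite /played -eq_v pv.
Qed.

Lemma move_play p a :
    irreflexive arc -> admissible arc p ->
    (forall b, played p b -> compatible a b) ->
  p a.1 = None /\ move arc p (play p a).
Proof.
move=> irr /admissibleP adm ok.
have pa : p a.1 = None.
  case pa: (p a.1) => [c|] //; have := ok (a.1, c).
  by rewrite /played /compatible /= pa !eqxx => /(_ isT).
split=> //; apply/andP; split.
  by apply/existsP; exists a.1; apply/existsP; exists a.2; rewrite pa !eqxx.
apply/admissibleP => b d; rewrite !played_play //.
case/predU1P=> [->|pb] /predU1P[->|pd].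
- by rewrite /respects_arc irr.
- by case/and3P: (ok d pd).
- by case/and3P: (ok b pb).
- exact: adm.
Qed.

(** Once the played moves form a set closed under [phi], the reply [phi a] to
[a] clashes with an old move [b] only if [a] clashed with the old move
[phi b]. *)
Lemma P_position_pairing (phi : V * color -> V * color) :
    irreflexive arc -> involutive phi ->
    {mono phi : a b / compatible a b} ->
    (forall a, compatible a (phi a)) ->
  P_position arc start.
Proof.
move=> irr phiK phi_mono phi_compat.
pose inv p := admissible arc p && [forall a, played p a ==> played p (phi a)].
apply: (@P_position_invariant inv) => [|p q].
  by apply/andP; split; [apply/admissibleP => a b|apply/forallP => a];
    rewrite /played ffunE.
case/andP=> adm_p /forallP phi_p p_q.
have adm_q : admissible arc q by case/andP: p_q.
have {p_q} [a [pa q_def a_ok]] := moveP p_q.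
have in_q b : played q b = (b == a) || played p b.
  by rewrite q_def played_play.
have phi_ok b : played q b -> compatible (phi a) b.
  rewrite in_q => /predU1P[->|pb]; first by rewrite compatible_sym.
  by rewrite -[b]phiK phi_mono; apply/a_ok/(implyP (phi_p b)).
have [q_phi q_r] := move_play irr adm_q phi_ok.
exists (play q (phi a)) => //.
apply/andP; split; first by case/andP: q_r.
apply/forallP => b; apply/implyP; rewrite !played_play // !in_q.
case/or3P=> [/eqP->|/eqP->|pb]; first by rewrite phiK eqxx orbT.
  by rewrite eqxx.
by rewrite (implyP (phi_p b)) ?orbT.
Qed.

End Strategies.

(** * The cycle of length l as a circle of 2l moves *)

Section Cycle.

Variable l : nat.
Implicit Types (a b : 'I_l * color).

Lemma val_ordS (x : 'I_l) : val (ordS x) = if x.+1 == l then 0 else x.+1.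
Proof.
rewrite /=; case: eqP => [->|/eqP neq]; first by rewrite modnn.
by rewrite modn_small // ltn_neqAle neq ltn_ord.
Qed.

Definition code a : nat := a.1.*2 + (a.2 == Red).

Lemma code_lt a : code a < l.*2.
Proof. by rewrite /code; case: a => [[x /= ltx] []] /=; lia. Qed.

Lemma code_inj : injective code.
Proof.
move=> [x c] [y d]; rewrite /code /= => eq_code.
have eq_xy : x = y by apply: val_inj => /=; case: c d eq_code => [] []; lia.
by rewrite -{}eq_xy in eq_code *; case: c d eq_code => [] [] //=; lia.
Qed.

(** One of the two truncated differences is zero, so their sum [k] is the
distance of the codes.  As codes lie below [2 l], the circular distance
[min k (2 l - k)] exceeds 2 iff [2 < k < 2 l - 2]. *)
Lemma compatible_cycle a b :
    2 < l ->
  compatible (@directed_cycle l) a b =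
    (2 < (code a - code b) + (code b - code a) < l.*2 - 2).
Proof.
move=> l_gt2; case: a b => [x c] [y d].
rewrite /compatible /respects_arc /directed_cycle /code /=.
rewrite -!(inj_eq val_inj) !val_ordS /=.
have := ltn_ord x; have := ltn_ord y; move: (nat_of_ord x) (nat_of_ord y).
move=> {}x {}y lty ltx.
have BnR : (Blue == Red) = false by [].
case: (x.+1 =P l) (y.+1 =P l) c d => [?|?] [?|?] [] [] /=;
  by rewrite ?eqxx ?BnR; lia.
Qed.

Definition antipodal_code k : nat := if k < l then k + l else k - l.

Definition antipode a : 'I_l * color :=
  let k := antipodal_code (code a) in
  (insubd a.1 k./2, if odd k then Red else Blue).

Lemma code_antipode a : code (antipode a) = antipodal_code (code a).
Proof.
have lt_k : antipodal_code (code a) < l.*2.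
  by have := code_lt a; rewrite /antipodal_code; case: ifP; lia.
rewrite {1}/code /antipode /= val_insubd; set k := antipodal_code _ in lt_k *.
rewrite ifT; last by lia.
have -> : ((if odd k then Red else Blue) == Red) = odd k by case: odd.
by rewrite addnC odd_double_half.
Qed.

Lemma antipodeK : involutive antipode.
Proof.
move=> a; apply: code_inj; rewrite !code_antipode.
by have := code_lt a; rewrite /antipodal_code; do 2!case: ifP; lia.
Qed.

End Cycle.

Theorem corollary11 (l : nat) (hl : 3 < l) :
  P_position (@directed_cycle l) start.
Proof.
have l_gt2 : 2 < l by exact: ltnW.
apply: (@P_position_pairing _ _ (@antipode l)) => [x||a b|a].
- rewrite /directed_cycle -(inj_eq val_inj) val_ordS /=.
  by move: (nat_of_ord x) => {}x; case: (x.+1 =P l); lia.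
- exact: antipodeK.
- rewrite !compatible_cycle // !code_antipode /antipodal_code.
  by have := code_lt a; have := code_lt b; do 2!case: ifP; lia.
- rewrite compatible_cycle // code_antipode /antipodal_code.
  by have := code_lt a; case: ifP; lia.
Qed.
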